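(* Let $0<p<1$ and $0<\varepsilon<1$, and let $\mathbb{Q}$ be the law on $\{-1,1\}^{\mathbb{Z}_+}$ of the hidden Markov process $Y_n=X_n\cdot Z_n$, where $\{X_n\}$ is the stationary symmetric $\{\pm1\}$-valued Markov chain with $\mathbb{P}(X_{n+1}\neq X_n)=p$ and $\{Z_n\}$ is an independent i.i.d. sequence with $\mathbb{P}_Z(Z_n=-1)=\varepsilon$, $\mathbb{P}_Z(Z_n=1)=1-\varepsilon$. Then $\mathbb{Q}$ is a $g$-measure for some positive continuous function $g$ with exponential decay of variation: there are $C>0$ and $\rho\in(0,1)$ such that $$\mathrm{var}_n(g):=\sup\bigl\{|g(\boldsymbol{y})-g(\tilde{\boldsymbol{y}})| : \boldsymbol{y},\tilde{\boldsymbol{y}}\in\{-1,1\}^{\mathbb{Z}_+},\ y_i=\tilde y_i \text{ for } 0\le i\le n-1\bigr\}\le C\rho^n$$ for all $n$, and the decay rate $\rho$ satisfies the estimate $$\rho\le\rho^*(p,\varepsilon)<|1-2p|,$$ where $\rho^*(p,\varepsilon)$ depends only on $p$ and $\varepsilon$.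
   Context: $\mathbb{Z}_+=\{0,1,2,\dots\}$. The chain $\{X_n\}$ has uniform stationary distribution and transition probabilities $p_{x,x'}=p$ if $x\ne x'$ and $1-p$ if $x=x'$. Explicitly, for $y_0,\dots,y_n\in\{-1,1\}$, $$\mathbb{Q}(Y_0=y_0,\dots,Y_n=y_n)=\sum_{x_0,\dots,x_n\in\{-1,1\}}\frac12\prod_{i=0}^{n-1}p_{x_i,x_{i+1}}\cdot \varepsilon^{\#\{0\le i\le n:\,x_iy_i=-1\}}(1-\varepsilon)^{\#\{0\le i\le n:\,x_iy_i=1\}} .$$ A fully supported translation invariant (under the left shift) Borel probability measure $\mathbb{P}$ on $\Omega=\{-1,1\}^{\mathbb{Z}_+}$ (product topology) is a $g$-measure for a positive continuous $g:\Omega\to(0,1)$ if $\sum_{\bar\omega_0\in\{-1,1\}}g(\bar\omega_0,\omega_1,\omega_2,\dots)=1$ for all $\boldsymbol\omega\in\Omega$ and $\mathbb{P}(\omega_0\mid\omega_1,\omega_2,\dots)=g(\omega_0,\omega_1,\dots)$ for $\mathbb{P}$-a.a. $\boldsymbol\omega$.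
   Formalization: The strict inequality ρ*(p,ε)<|1-2p| is claimed only for p≠1/2, since at p=1/2 it would require 0<ρ≤ρ*<0; all other conclusions, including ρ in (0,1) and ρ≤ρ*(p,ε), are claimed for every 0<p<1. *)

(* Defs.v *)
From mathcomp Require Import all_boot all_order all_algebra.
From mathcomp Require Import all_classical all_reals all_analysis.

Set Implicit Arguments.
Unset Strict Implicit.
Unset Printing Implicit Defensive.

Import Order.TTheory GRing.Theory Num.Theory.
Import numFieldNormedType.Exports.

Local Open Scope classical_set_scope.
Local Open Scope ring_scope.

(* The alphabet {-1, 1} is carried by bool (which has the discrete topology
   and sigma-algebra): b stands for (-1)^b, i.e. true is -1 and false is 1.
   Under this identification the product of signs is exclusive or. *)
Notation spin := bool (only parsing).

Definition minus1 : spin := true.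
Definition plus1 : spin := false.
Definition spin_val (b : spin) : int := (-1) ^+ b.
Definition spin_mul (x z : spin) : spin := x (+) z.

Lemma spin_val_minus1 : spin_val minus1 = -1. Proof. by []. Qed.
Lemma spin_val_plus1 : spin_val plus1 = 1. Proof. by []. Qed.
Lemma spin_valM x z : spin_val (spin_mul x z) = spin_val x * spin_val z.
Proof. exact: signr_addb. Qed.

(* Omega: nat -> {-1, 1} with the product topology; borelOmega is the same
   type with its Borel sigma-algebra. *)
Notation Omega := cantor_space.
Notation borelOmega := (g_sigma_algebraType (@open cantor_space)).

Definition left_shift (w : Omega) : Omega := fun n => w n.+1.

Definition scons (a : spin) (w : Omega) : Omega :=
  fun n => if n is m.+1 then w m else a.

Section GMeasure.
Context {R : realType}.

(* h is a version of the conditional probability mu(E | G), for a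
   sub-sigma-algebra G *)
Definition is_cond_prob d (T : measurableType d) (mu : probability T R)
    (G : set (set T)) (E : set T) (h : T -> R) : Prop :=
  [/\ forall B : set R, measurable B -> G (h @^-1` B),
      mu.-integrable setT (EFin \o h) &
      forall A, G A -> (\int[mu]_(w in A) (h w)%:E = mu (E `&` A))%E].

(* sigma(w_1, w_2, ...), i.e. the sigma-algebra generated by the shift *)
Definition future_algebra : set (set borelOmega) :=
  preimage_set_system setT (left_shift : borelOmega -> borelOmega) measurable.

Definition fully_supported (Q : probability borelOmega R) : Prop :=
  forall U : set Omega, open U -> U !=set0 -> (0 < Q U)%E.

Definition translation_invariant (Q : probability borelOmega R) : Prop :=
  forall A : set borelOmega, measurable A -> Q (left_shift @^-1` A) = Q A.

(* cp a is a version of Q(w_0 = a | w_1, w_2, ...), so cp (w 0) w is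
   Q(w_0 | w_1, w_2, ...) *)
Definition is_g_measure (Q : probability borelOmega R) (g : Omega -> R) : Prop :=
  [/\ fully_supported Q,
      translation_invariant Q,
      continuous g /\ (forall w, 0 < g w < 1),
      (forall w, \sum_(a : spin) g (scons a (left_shift w)) = 1) &
      exists cp : spin -> borelOmega -> R,
        (forall a, is_cond_prob Q future_algebra
                     [set w : borelOmega | w 0%N = a] (cp a)) /\
        {ae Q, forall w : borelOmega, cp (w 0%N) w = g w}].

Definition var_g (g : Omega -> R) (n : nat) : \bar R :=
  ereal_sup [set e | exists y y' : Omega,
    (forall i, (i < n)%N -> y i = y' i) /\ e = `|g y - g y'|%:E].

End GMeasure.

Section Processes.
Context {R : realType} d (T : measurableType d) (P : probability T R).

Definition trajectory (X : nat -> T -> spin) (w : T) : Omega :=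
  fun n => X n w.

Definition is_law (Y : nat -> T -> spin) (Q : probability borelOmega R) : Prop :=
  forall A : set borelOmega, measurable A -> Q A = P (trajectory Y @^-1` A).

Definition markov_chain (mu0 : spin -> R) (K : spin -> spin -> R)
    (X : nat -> T -> spin) : Prop :=
  (forall a, P [set w | X 0%N w = a] = (mu0 a)%:E) /\
  (forall (n : nat) (x : nat -> spin),
    P [set w | forall i, (i <= n.+1)%N -> X i w = x i] =
    (P [set w | forall i, (i <= n)%N -> X i w = x i] *
     (K (x n) (x n.+1))%:E)%E).

Definition symmetric_kernel (p : R) (x x' : spin) : R :=
  if x != x' then p else 1 - p.

Definition stationary_symmetric_chain (p : R) (X : nat -> T -> spin) : Prop :=
  markov_chain (fun=> 2^-1) (symmetric_kernel p) X.

Definition mutually_independent (Z : nat -> T -> spin) : Prop :=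
  forall (s : seq nat) (B : nat -> set spin), uniq s ->
    P (\bigcap_(i in [set` s]) (Z i @^-1` B i)) =
    (\prod_(i <- s) P (Z i @^-1` B i))%E.

Definition iid_noise (eps : R) (Z : nat -> T -> spin) : Prop :=
  [/\ mutually_independent Z,
      forall n, P [set w | Z n w = minus1] = eps%:E &
      forall n, P [set w | Z n w = plus1] = (1 - eps)%:E].

Definition independent_processes (X Z : nat -> T -> spin) : Prop :=
  forall A B : set borelOmega, measurable A -> measurable B ->
    (P (trajectory X @^-1` A `&` trajectory Z @^-1` B) =
     P (trajectory X @^-1` A) * P (trajectory Z @^-1` B))%E.

End Processes.

(* Main.v *)
(* Put l = 1 - 2p, th = 1 - 2 eps and let u(s) be the conditional mean of X_0
   given that the observations start with s.  Bayes' rule gives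
   u(y s) = (th y + l u(s)) / (1 + th y l u(s)) and
   Q(y_0 | y_1, y_2, ...) = (1 + th y_0 l u(y_1 y_2 ...)) / 2.
   One Bayes step multiplies sinh^2 of the hyperbolic distance between u and v
   by k(u) k(v), where k(u) = |l| (1 - u^2) / (1 - l^2 u^2) <= |l|, with equality
   (for l <> 0) only at u = 0.  As a step with th <> 0 leaves every neighbourhood
   of 0 that is small with respect to th, two consecutive steps contract by a
   rate strictly better than |l|^2.  Hence u extends to infinite sequences with
   exponential speed, and g is obtained from this extension.  That g is the
   conditional probability is checked on cylinders, by cutting a cylinder into
   longer and longer ones, on which u is almost constant. *)
Require Import Defs.
From mathcomp Require Import all_boot all_order all_algebra.
From mathcomp Require Import all_classical all_reals all_analysis.
From mathcomp Require Import ring lra.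
Set Implicit Arguments.
Unset Strict Implicit.
Import Order.TTheory GRing.Theory Num.Theory.
Import numFieldNormedType.Exports.
Local Open Scope classical_set_scope.
Local Open Scope ring_scope.

Section BackwardFilter.
Variables (R : realFieldType) (l : R).
Hypothesis l1 : -1 < l < 1.

Definition bayes (a u : R) : R := (a + l * u) / (1 + a * (l * u)).

(* [sinh (artanh u - artanh v) ^+ 2] *)
Definition dist2 (u v : R) : R := (u - v) ^+ 2 / ((1 - u ^+ 2) * (1 - v ^+ 2)).

Definition contraction (u : R) : R :=
  `|l| * (1 - u ^+ 2) / (1 - l ^+ 2 * u ^+ 2).

Lemma sqr_lt1 (u : R) : -1 < u < 1 -> 0 < 1 - u ^+ 2.
Proof. by move=> /andP[u1 u2]; nra. Qed.

Lemma mul_lt1 (a u : R) : -1 < a < 1 -> -1 < u < 1 -> -1 < a * u < 1.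
Proof.
rewrite -!ltr_norml normrM => a1 u1.
by rewrite (le_lt_trans _ u1)// ler_piMl// ltW.
Qed.

Lemma bayes_den_gt0 (a u : R) : -1 < a < 1 -> -1 < u < 1 -> 0 < 1 + a * (l * u).
Proof. by move=> a1 u1; have /andP[? ?] := mul_lt1 a1 (mul_lt1 l1 u1); lra. Qed.

Lemma one_sub_bayes_sqr (a u : R) : -1 < a < 1 -> -1 < u < 1 ->
  1 - bayes a u ^+ 2 =
  (1 - a ^+ 2) * (1 - l ^+ 2 * u ^+ 2) / (1 + a * (l * u)) ^+ 2.
Proof.
move=> a1 u1; have := lt0r_neq0 (bayes_den_gt0 a1 u1); rewrite /bayes => d0.
by field.
Qed.

Lemma contraction_den_gt0 (u : R) : -1 < u < 1 -> 0 < 1 - l ^+ 2 * u ^+ 2.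
Proof. by move=> u1; rewrite -exprMn; apply: sqr_lt1; exact: mul_lt1. Qed.

Lemma bayes_lt1 (a u : R) : -1 < a < 1 -> -1 < u < 1 -> -1 < bayes a u < 1.
Proof.
move=> a1 u1; have : 0 < 1 - bayes a u ^+ 2.
  rewrite one_sub_bayes_sqr//; apply: divr_gt0.
    by apply: mulr_gt0; [exact: sqr_lt1|exact: contraction_den_gt0].
  by apply: exprn_gt0; exact: bayes_den_gt0.
by move=> h; apply/andP; split; nra.
Qed.

Lemma dist2_bayes (a u v : R) : -1 < a < 1 -> -1 < u < 1 -> -1 < v < 1 ->
  dist2 (bayes a u) (bayes a v) = contraction u * contraction v * dist2 u v.
Proof.
move=> a1 u1 v1; rewrite /dist2 !one_sub_bayes_sqr// /contraction.
have du := lt0r_neq0 (bayes_den_gt0 a1 u1).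
have dv := lt0r_neq0 (bayes_den_gt0 a1 v1).
have ku := lt0r_neq0 (contraction_den_gt0 u1).
have kv := lt0r_neq0 (contraction_den_gt0 v1).
have su := lt0r_neq0 (sqr_lt1 u1); have sv := lt0r_neq0 (sqr_lt1 v1).
have sa := lt0r_neq0 (sqr_lt1 a1).
have -> : bayes a u - bayes a v = l * (1 - a ^+ 2) * (u - v) /
    ((1 + a * (l * u)) * (1 + a * (l * v))).
  by rewrite /bayes; field; rewrite du dv.
have -> : `|l| * (1 - u ^+ 2) / (1 - l ^+ 2 * u ^+ 2) *
    (`|l| * (1 - v ^+ 2) / (1 - l ^+ 2 * v ^+ 2)) =
    l ^+ 2 * ((1 - u ^+ 2) * (1 - v ^+ 2)) /
    ((1 - l ^+ 2 * u ^+ 2) * (1 - l ^+ 2 * v ^+ 2)).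
  move: (1 - l ^+ 2 * u ^+ 2) ku (1 - l ^+ 2 * v ^+ 2) kv => A A0 B B0.
  by rewrite -(@real_normK _ l) ?num_real//; field; rewrite A0 B0.
move: du dv ku kv su sv sa; move: (1 + a * (l * u)) (1 + a * (l * v)) => d e.
move: (1 - l ^+ 2 * u ^+ 2) (1 - l ^+ 2 * v ^+ 2) (1 - u ^+ 2) => A B U.
move: (1 - v ^+ 2) (1 - a ^+ 2) => V a' d0 e0 A0 B0 U0 V0 a0.
by field; rewrite d0 e0 A0 B0 U0 V0 a0.
Qed.

Lemma dist2_ge (u v : R) : -1 < u < 1 -> -1 < v < 1 -> (u - v) ^+ 2 <= dist2 u v.
Proof.
move=> u1 v1; have su := sqr_lt1 u1; have sv := sqr_lt1 v1.
rewrite /dist2 ler_pdivlMr ?mulr_gt0// ler_piMr ?sqr_ge0//.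
by apply: mulr_ile1; rewrite ?(ltW su) ?(ltW sv) ?gerBl ?sqr_ge0.
Qed.

Lemma contraction_ge0 (u : R) : -1 < u < 1 -> 0 <= contraction u.
Proof.
move=> u1; rewrite /contraction divr_ge0 ?mulr_ge0// ltW//.
  exact: sqr_lt1.
exact: contraction_den_gt0.
Qed.

Lemma l2_lt1 : l ^+ 2 < 1.
Proof. by have := sqr_lt1 l1; lra. Qed.

Lemma contraction_le (u : R) : -1 < u < 1 ->
  contraction u <= `|l| * (1 - (1 - l ^+ 2) * u ^+ 2).
Proof.
move=> u1; rewrite /contraction -mulrA ler_wpM2l//.
rewrite ler_pdivrMr ?contraction_den_gt0//.
have : 0 <= l ^+ 2 * (1 - l ^+ 2) * (u ^+ 2) ^+ 2.
  by rewrite mulr_ge0 ?sqr_ge0// mulr_ge0 ?sqr_ge0// subr_ge0 ltW// l2_lt1.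
by move: (l ^+ 2) (u ^+ 2) => L U; rewrite expr2; lra.
Qed.

Lemma contraction_le_norm (u : R) : -1 < u < 1 -> contraction u <= `|l|.
Proof.
move=> u1; rewrite (le_trans (contraction_le u1))// ler_piMr//.
rewrite gerBl mulr_ge0 ?sqr_ge0//; have := l2_lt1; lra.
Qed.

(* The contraction at u is strict unless u is near 0, and one Bayes step
   moves a neighbourhood of 0 away from 0. *)
Lemma bayes_away0 (a u : R) : -1 < a < 1 -> -1 < u < 1 ->
  a ^+ 2 / 16 <= u ^+ 2 \/ a ^+ 2 / 16 <= bayes a u ^+ 2.
Proof.
move=> a1 u1; case: (lerP (a ^+ 2 / 16) (u ^+ 2)) => [|h]; [by left|right].
rewrite /bayes expr_div_n ler_pdivlMr ?exprn_gt0 ?bayes_den_gt0//.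
have l2 : (l * u) ^+ 2 <= a ^+ 2 / 16.
  rewrite exprMn (le_trans _ (ltW h))// ler_piMl ?sqr_ge0//.
  by rewrite ltW// l2_lt1.
have a2 : a ^+ 2 <= 1 by have := sqr_lt1 a1; lra.
move: (l * u) l2 => v v2.
have s0 := sqr_ge0 (a + 2 * v); have s1 := sqr_ge0 (1 - a * v).
have av : (1 + a * v) ^+ 2 <= 4.
  have : (a * v) ^+ 2 <= 1 by rewrite exprMn mulr_ile1 ?sqr_ge0//; lra.
  by move: s1; rewrite !expr2; lra.
have : a ^+ 2 / 16 * (1 + a * v) ^+ 2 <= a ^+ 2 / 16 * 4.
  by rewrite ler_wpM2l// divr_ge0// sqr_ge0.
move: s0 v2 => {s1 av h}; move: ((1 + a * v) ^+ 2) => W.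
have -> : (a + 2 * v) ^+ 2 = 2 * (a + v) ^+ 2 - a ^+ 2 + 2 * v ^+ 2 by ring.
by have := sqr_ge0 a; lra.
Qed.

Lemma contraction_two_steps (a u : R) : -1 < a < 1 -> -1 < u < 1 ->
  contraction u * contraction (bayes a u) <=
  (`|l| * (1 - (1 - l ^+ 2) * a ^+ 2 / 32)) ^+ 2.
Proof.
move=> a1 u1; have b1 := bayes_lt1 a1 u1.
have L := l2_lt1.
have strict v : -1 < v < 1 -> a ^+ 2 / 16 <= v ^+ 2 ->
    contraction v <= `|l| * (1 - (1 - l ^+ 2) * (a ^+ 2 / 16)).
  move=> v1 av; rewrite (le_trans (contraction_le v1))// ler_wpM2l// lerB//.
  by rewrite ler_wpM2l// subr_ge0 ltW.
apply: (@le_trans _ _ (`|l| * (`|l| * (1 - (1 - l ^+ 2) * (a ^+ 2 / 16))))).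
  have [h|h] := bayes_away0 a1 u1.
    by rewrite mulrC ler_pM ?contraction_ge0 ?contraction_le_norm// strict.
  by rewrite ler_pM ?contraction_ge0 ?contraction_le_norm// strict.
rewrite exprMn mulrA -expr2 ler_wpM2l ?sqr_ge0//.
have -> : (1 - l ^+ 2) * (a ^+ 2 / 16) = 2 * ((1 - l ^+ 2) * a ^+ 2 / 32) by field.
move: (_ / 32) => x; have -> : (1 - x) ^+ 2 = 1 - 2 * x + x ^+ 2 by ring.
by rewrite lerDl sqr_ge0.
Qed.

Variable th : R.
Hypothesis th1 : -1 < th < 1.

Definition filter_step (y : bool) (u : R) : R := bayes ((-1) ^+ y * th) u.

(* [posterior s] is the conditional mean of the hidden spin X_0 given that the
   observations Y_0, Y_1, ... start with [s]; it is computed by Bayes' rule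
   from the last observation backwards. *)
Definition posterior (s : seq bool) : R := foldr filter_step 0 s.

Definition rate : R :=
  if l == 0 then 2^-1 else if th == 0 then `|l| / 2
  else `|l| * (1 - (1 - l ^+ 2) * th ^+ 2 / 32).

Lemma signed_lt1 (y : bool) : -1 < (-1) ^+ y * th < 1.
Proof. by case: y; move: th1; rewrite -!ltr_norml ?mulN1r ?mul1r ?normrN. Qed.

Lemma filter_lt1 s (u : R) : -1 < u < 1 -> -1 < foldr filter_step u s < 1.
Proof. by move=> u1; elim: s => //= y s; apply: bayes_lt1; exact: signed_lt1. Qed.

Lemma posterior_lt1 s : -1 < posterior s < 1.
Proof. by apply: filter_lt1; rewrite ltrN10 ltr01. Qed.

Lemma posterior_cat s t : posterior (s ++ t) = foldr filter_step (posterior t) s.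
Proof. exact: foldr_cat. Qed.

Lemma rate_lt_norm : l != 0 -> rate < `|l|.
Proof.
move=> l0; have n0 : 0 < `|l| by rewrite normr_gt0.
rewrite /rate (negbTE l0); case: eqP => [_|/eqP t0]; first by lra.
rewrite gtr_pMr// ltrBlDr ltrDl divr_gt0// mulr_gt0 ?subr_gt0 ?l2_lt1//.
by rewrite lt0r sqrf_eq0 t0 sqr_ge0.
Qed.

Lemma rate_lt1 : 0 < rate < 1.
Proof.
have [l0|l0] := eqVneq l 0.
  by rewrite /rate l0 eqxx; apply/andP; split; lra.
apply/andP; split; last by rewrite (lt_trans (rate_lt_norm l0))// ltr_norml.
have n0 : 0 < `|l| by rewrite normr_gt0.
rewrite /rate (negbTE l0); case: eqP => [_|/eqP t0]; first by lra.
rewrite mulr_gt0//.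
have : (1 - l ^+ 2) * th ^+ 2 <= 1.
  have := sqr_lt1 th1; have := sqr_lt1 l1; have := sqr_ge0 th; have := sqr_ge0 l.
  by move=> *; rewrite mulr_ile1//; lra.
by lra.
Qed.

Lemma rate_two_steps (y : bool) (u : R) : th != 0 -> -1 < u < 1 ->
  contraction u * contraction (filter_step y u) <= rate ^+ 2.
Proof.
move=> t0 u1; have := contraction_two_steps (signed_lt1 y) u1.
rewrite [(_ * th) ^+ 2]exprMn sqrr_sign mul1r => /le_trans; apply.
rewrite /rate; case: eqP => [->|_]; last by rewrite (negbTE t0).
by rewrite normr0 mul0r expr0n/= sqr_ge0.
Qed.

Lemma dist2_filter s (u v : R) : th != 0 -> -1 < u < 1 -> -1 < v < 1 ->
  rate ^+ 2 * dist2 (foldr filter_step u s) (foldr filter_step v s) <=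
  rate ^+ (2 * size s) * dist2 u v.
Proof.
move=> t0 u1 v1; have /andP[r0 r1] := rate_lt1.
have d0 u' v' : -1 < u' < 1 -> -1 < v' < 1 -> 0 <= dist2 u' v'.
  by move=> ? ?; apply: le_trans (dist2_ge _ _); rewrite ?sqr_ge0.
have [n] := ubnP (size s); elim: n s => // n IH [|y [|z s]] /= sn.
- by rewrite expr0 ler_wpM2r ?d0// expr_le1// ltW.
- rewrite muln1 /filter_step dist2_bayes ?signed_lt1// ler_wpM2l ?exprn_ge0 ?(ltW r0)//.
  rewrite ler_piMl ?d0// mulr_ile1 ?contraction_ge0//.
    by rewrite (le_trans (contraction_le_norm _))// ltW// ltr_norml.
  by rewrite (le_trans (contraction_le_norm _))// ltW// ltr_norml.
- have us := filter_lt1 s u1; have vs := filter_lt1 s v1.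
  rewrite {1 3}/filter_step !dist2_bayes ?signed_lt1 ?bayes_lt1 ?signed_lt1//.
  set D := dist2 _ _; set ku' := contraction (bayes _ _).
  set kv' := contraction (bayes _ _).
  have D0 : 0 <= D by exact: d0.
  have -> : ku' * kv' * (contraction (foldr filter_step u s) *
      contraction (foldr filter_step v s) * D) =
    (contraction (foldr filter_step u s) * ku') *
    (contraction (foldr filter_step v s) * kv') * D by ring.
  have R4 : (contraction (foldr filter_step u s) * ku') *
    (contraction (foldr filter_step v s) * kv') <= rate ^+ 2 * rate ^+ 2.
    apply: ler_pM; [| |exact: rate_two_steps..].
      by rewrite mulr_ge0 ?contraction_ge0 ?bayes_lt1 ?signed_lt1.
    by rewrite mulr_ge0 ?contraction_ge0 ?bayes_lt1 ?signed_lt1.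
  have IHs := IH s (ltn_trans (ltnSn _) sn); rewrite -/D in IHs.
  have -> : (2 * (size s).+2)%N = (4 + 2 * size s)%N by rewrite !mulnS addnA.
  rewrite exprD -[leRHS]mulrA.
  apply: (@le_trans _ _ (rate ^+ 4 * (rate ^+ 2 * D))).
    rewrite mulrCA; apply: ler_wpM2r.
      exact: mulr_ge0 (exprn_ge0 _ (ltW r0)) D0.
    by apply: (le_trans R4); rewrite -exprD.
  by rewrite ler_wpM2l ?exprn_ge0 ?(ltW r0).
Qed.

Lemma posterior_prefix : exists2 K : R, 0 < K & forall s t t',
  `|posterior (s ++ t) - posterior (s ++ t')| <= K * rate ^+ size s.
Proof.
have /andP[r0 r1] := rate_lt1.
have [t0|t0] := eqVneq th 0.
  have post0 s : posterior s = 0.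
    elim: s => //= y s IH; rewrite -/(posterior s) IH.
    by rewrite /filter_step /bayes t0 !mulr0 addr0 mul0r.
  by exists 1 => // s t t'; rewrite !post0 subrr normr0 mul1r exprn_ge0// ltW.
pose c := (1 - th ^+ 2) * (1 - l ^+ 2) / 4.
have st := sqr_lt1 th1; have sl := sqr_lt1 l1.
have c0 : 0 < c by rewrite divr_gt0// mulr_gt0.
have postc s : c <= 1 - posterior s ^+ 2.
  case: s => [|y s] /=.
    rewrite expr0n/= subr0 /c; have := sqr_ge0 th; have := sqr_ge0 l; nra.
  rewrite -/(posterior s); have p1 := posterior_lt1 s.
  rewrite /filter_step one_sub_bayes_sqr ?signed_lt1// exprMn sqrr_sign mul1r /c.
  have d0 := bayes_den_gt0 (signed_lt1 y) p1.
  have /andP[_ dle] := mul_lt1 (signed_lt1 y) (mul_lt1 l1 p1).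
  rewrite ler_pM ?invr_ge0//.
  - by rewrite mulr_ge0// ltW.
  - rewrite ler_wpM2l ?(ltW st)// lerB// ler_piMr ?sqr_ge0//.
    by have := sqr_lt1 p1; lra.
  - rewrite lef_pV2 ?posrE ?exprn_gt0//.
    rewrite (_ : 4 = 2 ^+ 2 :> R); last by ring.
    by rewrite ler_sqr ?nnegrE ?ltW//; lra.
pose K := 2 / (c * rate).
have K0 : 0 < K by rewrite divr_gt0// mulr_gt0.
exists K => //.
move=> s t t'; rewrite !posterior_cat.
have p1 := posterior_lt1 t; have p1' := posterior_lt1 t'.
have := dist2_filter s t0 p1 p1'.
have /(ler_wpM2l (exprn_ge0 2 (ltW r0))) := dist2_ge (filter_lt1 s p1) (filter_lt1 s p1').
set U := foldr _ (posterior t) s; set V := foldr _ _ s => h1 h2.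
have dc : dist2 (posterior t) (posterior t') <= (2 / c) ^+ 2.
  rewrite /dist2 expr_div_n ler_pM ?sqr_ge0 ?invr_ge0//.
  - by apply: mulr_ge0; rewrite (le_trans _ (postc _))// ltW.
  - move: p1 p1' => /andP[? ?] /andP[? ?].
    by rewrite -subr_ge0 subr_sqr mulr_ge0//; lra.
  - have pp a : 0 < 1 - posterior a ^+ 2 by exact: lt_le_trans (postc a).
    rewrite lef_pV2 ?posrE; [|exact: mulr_gt0 (pp _) (pp _)|exact: exprn_gt0].
    by rewrite expr2; apply: ler_pM; rewrite ?postc ?(ltW c0).
rewrite -ler_sqr ?nnegrE ?normr_ge0//; last first.
  by apply: mulr_ge0; [exact: ltW|exact/exprn_ge0/ltW].
rewrite real_normK ?num_real// -(ler_pM2l (exprn_gt0 2 r0)).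
apply: (le_trans h1); apply: (le_trans h2).
apply: (@le_trans _ _ (rate ^+ (2 * size s) * (2 / c) ^+ 2)).
  by rewrite ler_wpM2l// exprn_ge0// ltW.
rewrite mulnC exprM -!exprMn le_eqVlt; apply/orP; left; apply/eqP.
by congr (_ ^+ 2); rewrite /K; field; rewrite !gt_eqF.
Qed.

End BackwardFilter.

Definition cylinder (s : seq bool) : set borelOmega :=
  [set w | mkseq w (size s) = s].

Lemma mkseq_cons (w : cantor_space) n :
  mkseq w n.+1 = w 0 :: mkseq (left_shift w) n.
Proof. by rewrite /mkseq/= (iotaDl 1 0 n) -map_comp. Qed.

Lemma cylinder_mkseq (w : cantor_space) n : cylinder (mkseq w n) w.
Proof. by rewrite /cylinder/= size_mkseq. Qed.

Lemma cylinder0 : cylinder [::] = setT.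
Proof. by apply/seteqP; split. Qed.

Lemma cylinder_cons a s :
  cylinder (a :: s) = [set w | w 0%N = a] `&` left_shift @^-1` cylinder s.
Proof.
have E w : cylinder (a :: s) w = (mkseq w (size s).+1 = a :: s) by [].
apply/seteqP; split => w; rewrite E mkseq_cons.
  by case=> w0 ws; split.
by case=> /= -> <-; rewrite size_mkseq.
Qed.

Lemma cylinder_rcons s a :
  cylinder (rcons s a) = cylinder s `&` [set w | w (size s) = a].
Proof.
apply/seteqP; split => w; rewrite /cylinder/= size_rcons mkseqS.
  by move=> /rcons_inj[ws wa]; split.
by case=> /= -> ->.
Qed.

Lemma cylinder_split s :
  cylinder s = cylinder (rcons s false) `|` cylinder (rcons s true).
Proof.
rewrite !cylinder_rcons -setIUr; apply/seteqP; split => w; last by case.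
by move=> sw; split => //=; case: (w (size s)); [right|left].
Qed.

Lemma cylinder_rcons_disj s :
  [disjoint cylinder (rcons s false) & cylinder (rcons s true)].
Proof.
rewrite !cylinder_rcons; apply/eqP/seteqP; split => // w [[_ /= ->]] [_]//.
Qed.

Lemma eq_mkseqP (w w' : cantor_space) n :
  mkseq w n = mkseq w' n <-> forall i, (i < n)%N -> w i = w' i.
Proof.
split=> [h i ni|h]; last first.
  by apply/eq_in_map => i; rewrite mem_iota add0n => /h.
by rewrite -(nth_mkseq false w ni) h nth_mkseq.
Qed.

Lemma cylinder_mkseqP (w w' : cantor_space) n :
  cylinder (mkseq w n) w' <-> forall i, (i < n)%N -> w' i = w i.
Proof. by rewrite /cylinder/= size_mkseq; exact: eq_mkseqP. Qed.

Lemma nbhs_cylinder (w : cantor_space) (U : set cantor_space) :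
  nbhs w U -> exists n, cylinder (mkseq w n) `<=` U.
Proof.
move=> wU.
pose F := filter_from setT (fun n => cylinder (mkseq w n) : set cantor_space).
have FF : Filter F.
  apply: filter_from_filter; first by exists 0%N.
  move=> i j _ _; exists (maxn i j) => // v.
  move=> /cylinder_mkseqP vw; split; apply/cylinder_mkseqP => k ki.
    by apply: vw; rewrite leq_max ki.
  by apply: vw; rewrite leq_max ki orbT.
have : F --> w.
  have proj_surj i : @proj nat (fun=> bool) i @` setT = setT.
    by apply/seteqP; split => // b _; exists (fun=> b).
  apply/cvg_sup => i; apply/cvg_image; first exact: proj_surj.
  move=> A /nbhs_singleton Awi; exists (proj i @^-1` A); last first.
    by rewrite image_preimage// proj_surj.
  by exists i.+1 => // v /cylinder_mkseqP vw; rewrite /= /proj vw.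
by move=> /(_ _ wU)[n _ nU]; exists n.
Qed.

Lemma open_cylinder s : open (cylinder s : set cantor_space).
Proof.
elim/last_ind: s => [|s a IH]; first by rewrite cylinder0; exact: openT.
have oa : open (@proj nat (fun=> bool) (size s) @^-1` [set a] : set cantor_space).
  apply: open_comp => [w _|]; first exact: (@proj_continuous nat (fun=> bool)).
  exact: discrete_open.
rewrite cylinder_rcons; exact: (@openI cantor_space).
Qed.

Lemma measurable_cylinder s : measurable (cylinder s).
Proof. by apply: sub_sigma_algebra; exact: open_cylinder. Qed.

Definition cylinders : set (set borelOmega) :=
  set0 |` range cylinder.

Lemma cylinders_setI : setI_closed cylinders.
Proof.
move=> A B [->|[s _ <-]]; first by rewrite set0I; left.
move=> [->|[t _ <-]]; first by rewrite setI0; left.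
wlog st : s t / (size s <= size t)%N.
  move=> W; have [|/ltnW] := leqP (size s) (size t); first exact: W.
  by rewrite setIC; exact: W.
have [ts|ts] := eqVneq (take (size s) t) s.
  right; exists t => //; apply/seteqP; split => w; last by case.
  move=> wt; split => //; rewrite /cylinder/= -{2}ts -wt.
  by rewrite /mkseq -map_take take_iota; have /minn_idPl -> := st.
left; apply/seteqP; split => // w [ws wt]; move/eqP: ts; apply.
by rewrite -wt -{2}ws /mkseq -map_take take_iota; have /minn_idPl -> := st.
Qed.

Lemma measurable_cylinders :
  @measurable _ borelOmega = <<s cylinders>>.
Proof.
apply/seteqP; split; last first.
  apply: smallest_sub; first exact: smallest_sigma_algebra.
  move=> _ [->|[s _ <-]]; first exact: measurable0.
  exact: measurable_cylinder.
apply: smallest_sub; first exact: smallest_sigma_algebra.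
move=> U oU.
pose c n := cylinder (odflt [::] (unpickle n)).
have -> : U = \bigcup_(n in [set n | c n `<=` U]) c n.
  apply/seteqP; split => [w Uw|w [n nU]]; last exact: nU.
  have [|n nU] := @nbhs_cylinder w U; first by move: oU; rewrite openE => /(_ w Uw).
  have cE : c (pickle (mkseq w n)) = cylinder (mkseq w n) by rewrite /c pickleK.
  by exists (pickle (mkseq w n)); rewrite ?/mkset cE//; exact: cylinder_mkseq.
have [SC SD SU] := @smallest_sigma_algebra _ setT cylinders.
rewrite bigcup_mkcond; apply: SU => n; case: ifPn => // _.
by apply: sub_sigma_algebra; right; exists (odflt [::] (unpickle n)).
Qed.

Lemma shift_cylinder s :
  left_shift @^-1` cylinder s = cylinder (false :: s) `|` cylinder (true :: s).
Proof.
rewrite !cylinder_cons -setIUl; apply/seteqP; split => w /=; last by case.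
by move=> sw; split=> //; case: (w 0%N); [right|left].
Qed.

Lemma measurable_left_shift :
  measurable_fun setT (left_shift : borelOmega -> borelOmega).
Proof.
apply: (@measurability _ _ _ _ setT _ cylinders).
  exact: measurable_cylinders.
move=> _ [_ [->|[s _ <-]] <-]; first by rewrite preimage_set0 setI0; exact: measurable0.
rewrite setTI shift_cylinder.
by apply: measurableU; exact: measurable_cylinder.
Qed.

Lemma cylinderP s (w : cantor_space) :
  cylinder s w <-> forall i, (i < size s)%N -> w i = nth false s i.
Proof.
rewrite -{1}(mkseq_nth false s).
exact: (@cylinder_mkseqP (nth false s) w (size s)).
Qed.

Section CylinderProbability.
Variables (R : realType) (p eps : R).
Hypotheses (p01 : 0 < p < 1) (eps01 : 0 < eps < 1).

Let l : R := 1 - 2 * p.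
Let th : R := 1 - 2 * eps.
Let post := posterior l th.

Fixpoint cylinder_prob (s : seq bool) : R :=
  if s is y :: s' then
    cylinder_prob s' * ((1 + (-1) ^+ y * th * (l * post s')) / 2)
  else 1.

Definition noise_weight (z : bool) : R := if z then eps else 1 - eps.

(* The conditional probability that Y_0, Y_1, ... starts with [s] given
   X_0 = [a]. *)
Fixpoint emission (a : bool) (s : seq bool) : R :=
  if s is b :: s' then
    noise_weight (a (+) b) *
    (symmetric_kernel p a false * emission false s' +
     symmetric_kernel p a true * emission true s')
  else 1.

Lemma drift_lt1 : -1 < l < 1.
Proof. by move: p01 => /andP[? ?]; rewrite /l; apply/andP; split; lra. Qed.

Lemma noise_lt1 : -1 < th < 1.
Proof. by move: eps01 => /andP[? ?]; rewrite /th; apply/andP; split; lra. Qed.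

Lemma emissionE a s : emission a s = cylinder_prob s * (1 + (-1) ^+ a * post s).
Proof.
elim: s a => [|b s IH] a /=; first by rewrite /post/= mulr0 addr0 mul1r.
rewrite !IH /post/= -/(posterior l th s) -/post /filter_step /bayes.
have := bayes_den_gt0 drift_lt1 (signed_lt1 noise_lt1 b)
  (posterior_lt1 drift_lt1 noise_lt1 s).
rewrite -/post => /lt0r_neq0 d0; move: (cylinder_prob s) => c.
rewrite /noise_weight /symmetric_kernel; move: (post s) d0 => u.
by case: a; case: b => /=; rewrite ?expr1 ?expr0 ?mulN1r ?mul1r /th /l => d0; field.
Qed.

Lemma cylinder_prob_gt0 s : 0 < cylinder_prob s.
Proof.
elim: s => //= y s IH; apply: mulr_gt0 => //; apply: divr_gt0 => //.
apply: bayes_den_gt0; [exact: drift_lt1|exact: signed_lt1 noise_lt1 _|].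
exact: (posterior_lt1 drift_lt1 noise_lt1 s).
Qed.

Lemma cylinder_prob_cons2 s :
  cylinder_prob (false :: s) + cylinder_prob (true :: s) = cylinder_prob s.
Proof. by rewrite /= expr0 expr1; field. Qed.

Section HiddenMarkov.
Variables (d : measure_display) (T : measurableType d) (P : probability T R).
Variables (X Z : nat -> {RV P >-> bool}) (Q : probability borelOmega R).
Hypotheses (hX : stationary_symmetric_chain P p X) (hZ : iid_noise P eps Z).
Hypothesis hXZ : independent_processes P X Z.

Let Y n w := spin_mul (X n w) (Z n w).

Definition noise_prob (z : seq bool) : R := \prod_(c <- z) noise_weight c.

Lemma measurable_trajectory_cylinder (W : nat -> T -> bool) s :
  (forall n a, measurable [set w | W n w = a]) ->
  measurable (trajectory W @^-1` cylinder s).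
Proof.
move=> mW; elim/last_ind: s => [|s a IH].
  by rewrite cylinder0 preimage_setT.
by rewrite cylinder_rcons preimage_setI; apply: measurableI => //; exact: mW.
Qed.

Lemma measurable_rv (W : {RV P >-> bool}) a : measurable [set w | W w = a].
Proof.
have := @measurable_funP _ _ _ _ _ W measurableT [set a].
by rewrite setTI; apply.
Qed.

Lemma measurable_Y n a : measurable [set w | Y n w = a].
Proof.
have -> : [set w | Y n w = a] =
   ([set w | X n w = false] `&` [set w | Z n w = a]) `|`
   ([set w | X n w = true] `&` [set w | Z n w = ~~ a]).
  apply/seteqP; split => w /=; rewrite /Y /spin_mul.
    by move=> <-; case: (X n w) => /=; [right|left]; rewrite ?negbK.
  by move=> [[-> ->]|[-> ->]] //=; rewrite negbK.
by apply: measurableU; apply: measurableI; exact: measurable_rv.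
Qed.

Lemma prob_Z z : P (trajectory Z @^-1` cylinder z) = (noise_prob z)%:E.
Proof.
have [ind Zm Zp] := hZ.
have := ind (iota 0 (size z)) (fun i => [set nth false z i]) (iota_uniq _ _).
rewrite (_ : \bigcap_(i in _) _ = trajectory Z @^-1` cylinder z); last first.
  apply/seteqP; split => w /=.
    by move=> h; apply/cylinderP => i iz; apply: h; rewrite /= mem_iota.
  by move=> /cylinderP h i /=; rewrite mem_iota => iz; exact: h.
move=> ->.
rewrite /noise_prob -[in RHS](mkseq_nth false z) big_map -prodEFin.
apply: eq_bigr => i _; rewrite /noise_weight.
by case: (nth false z i); [exact: Zm|exact: Zp].
Qed.

Lemma prob_X0 a : P (trajectory X @^-1` cylinder [:: a]) = (2^-1)%:E.
Proof.
rewrite -(hX.1 a); congr (P _); apply/seteqP; split => w /=.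
  by move=> /cylinderP/(_ 0%N isT).
by move=> Xa; apply/cylinderP; case.
Qed.

Lemma prob_X_rcons s a b :
  P (trajectory X @^-1` cylinder (rcons (rcons s a) b)) =
  (P (trajectory X @^-1` cylinder (rcons s a)) * (symmetric_kernel p a b)%:E)%E.
Proof.
have := hX.2 (size s) (nth false (rcons (rcons s a) b)).
have E1 : [set w | forall i, (i <= (size s).+1)%N ->
    X i w = nth false (rcons (rcons s a) b) i] =
    trajectory X @^-1` cylinder (rcons (rcons s a) b).
  apply/seteqP; split => w /=.
    by move=> h; apply/cylinderP => i; rewrite !size_rcons => /h.
  by move=> /cylinderP h i; rewrite -ltnS -(size_rcons s a) -(size_rcons _ b) => /h.
have E2 : [set w | forall i, (i <= size s)%N ->
    X i w = nth false (rcons (rcons s a) b) i] =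
    trajectory X @^-1` cylinder (rcons s a).
  have N i : (i < size (rcons s a))%N ->
    nth false (rcons (rcons s a) b) i = nth false (rcons s a) i.
    by move=> h; rewrite nth_rcons h.
  apply/seteqP; split => w /=.
    move=> h; apply/cylinderP => i ia; rewrite -(N _ ia); apply: h.
    by rewrite size_rcons in ia.
  move=> /cylinderP h i; rewrite -ltnS -(size_rcons s a) => ia.
  by rewrite N//; exact: h.
rewrite E1 E2 => ->; congr (_ * (symmetric_kernel _ _ _)%:E)%E.
  by rewrite !nth_rcons size_rcons leqnn ltnn eqxx.
by rewrite nth_rcons size_rcons ltnn eqxx.
Qed.

Definition xor_seq (s t : seq bool) : seq bool :=
  [seq c.1 (+) c.2 | c <- zip s t].

Lemma xor_rcons s t a b : size s = size t ->
  xor_seq (rcons s a) (rcons t b) = rcons (xor_seq s t) (a (+) b).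
Proof. by move=> st; rewrite /xor_seq zip_rcons// map_rcons. Qed.

Lemma size_xor s t : size s = size t -> size (xor_seq s t) = size t.
Proof. by move=> st; rewrite size_map size1_zip ?st. Qed.

Lemma noise_prob_rcons s a : noise_prob (rcons s a) = noise_prob s * noise_weight a.
Proof. by rewrite /noise_prob -cats1 big_cat big_seq1. Qed.

Let XY x y := trajectory X @^-1` cylinder x `&` trajectory Y @^-1` cylinder y.

Lemma prob_XY_eq x y : size x = size y ->
  P (XY x y) = (P (trajectory X @^-1` cylinder x) * (noise_prob (xor_seq x y))%:E)%E.
Proof.
move=> xy; rewrite -prob_Z -hXZ; [|exact: measurable_cylinder..].
congr (P _); apply/seteqP; split => w [/= hx].
  move=> hy; split => //; move/cylinderP: hx => hx; move/cylinderP: hy => hy.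
  apply/cylinderP => i; rewrite size_xor// => iy.
  rewrite (nth_map (false, false)) ?size1_zip ?xy// nth_zip//=.
  rewrite -(hy _ iy) -hx ?xy//.
  by rewrite /trajectory/Y/spin_mul addbA addbb.
move=> hz; split => //; move/cylinderP: hx => hx; move/cylinderP: hz => hz.
apply/cylinderP => i iy; have := hz i; rewrite size_xor// => /(_ iy).
rewrite (nth_map (false, false)) ?size1_zip ?xy// nth_zip//= -hx ?xy//.
by rewrite /trajectory/Y/spin_mul => ->; rewrite addbA addbb.
Qed.

Lemma measurable_XY x y : measurable (XY x y).
Proof.
apply: measurableI; apply: measurable_trajectory_cylinder => n a.
  exact: measurable_rv.
exact: measurable_Y.
Qed.

Lemma prob_XY_split x y :
  P (XY x y) = (P (XY (rcons x false) y) + P (XY (rcons x true) y))%E.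
Proof.
rewrite -measureU; [| exact: measurable_XY..|].
  by rewrite /XY -setIUl -preimage_setU -cylinder_split.
rewrite /XY setIACA -preimage_setI.
have /eqP -> := cylinder_rcons_disj x.
by rewrite preimage_set0 set0I.
Qed.

Lemma prob_XY x y1 a b y2 : size x = size y1 ->
  P (XY (rcons x a) (y1 ++ b :: y2)) =
  (P (trajectory X @^-1` cylinder (rcons x a)) *
   (noise_prob (xor_seq x y1) * emission a (b :: y2))%:E)%E.
Proof.
elim: y2 x y1 a b => [|c y2 IH] x y1 a b xy.
  rewrite cats1 prob_XY_eq ?size_rcons ?xy// xor_rcons// noise_prob_rcons/=.
  congr (_ * _%:E)%E; rewrite -[LHS]mulr1 -mulrA; do 2 congr (_ * _).
  by rewrite /symmetric_kernel; case: a => /=; ring.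
rewrite prob_XY_split -cat_rcons !IH ?size_rcons ?xy// !prob_X_rcons.
rewrite xor_rcons// noise_prob_rcons.
rewrite -[P _]fineK; last first.
  apply: fin_num_measure; apply: measurable_trajectory_cylinder => n e.
  exact: measurable_rv.
by rewrite -!EFinM -EFinD; congr EFin; rewrite /=; ring.
Qed.

Hypothesis hQ : is_law P Y Q.

Lemma law_cylinder s : Q (cylinder s) = (cylinder_prob s)%:E.
Proof.
rewrite hQ; last exact: measurable_cylinder.
case: s => [|b s].
  by rewrite cylinder0 preimage_setT probability_setT.
have -> : trajectory Y @^-1` cylinder (b :: s) = XY [::] (b :: s).
  by rewrite /XY cylinder0 preimage_setT setTI.
rewrite prob_XY_split.
have E a := @prob_XY [::] [::] a b s erefl.
rewrite !{}E !emissionE !prob_X0 -!EFinM -EFinD; congr EFin.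
by rewrite /noise_prob big_nil expr0 expr1; field.
Qed.

End HiddenMarkov.
End CylinderProbability.

Lemma exists_expr_lt (R : realType) (C r e : R) : 0 < r < 1 -> 0 < e ->
  exists n, C * r ^+ n < e.
Proof.
move=> /andP[r0 r1] e0.
have : geometric C r @ \oo --> 0 by apply: cvg_geometric; rewrite gtr0_norm.
move=> /cvgr0Pnorm_lt/(_ _ e0)[n _ /(_ n)/= nP]; exists n.
by apply: le_lt_trans (nP _) => //; exact: ler_norm.
Qed.

Lemma le_expr_le0 (R : realType) (C r x : R) : 0 < r < 1 ->
  (forall n, x <= C * r ^+ n) -> x <= 0.
Proof.
move=> r01 h; rewrite leNgt; apply/negP => x0.
by have [n] := exists_expr_lt C r01 x0; rewrite ltNge h.
Qed.

Lemma continuous_cylinder (R : realType) (f : cantor_space -> R) (C r : R) :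
  0 < r < 1 ->
  (forall n w w', (forall i, (i < n)%N -> w i = w' i) ->
    `|f w - f w'| <= C * r ^+ n) ->
  continuous f.
Proof.
move=> r01 h w; apply/cvgrPdist_lt => e e0.
have [n ne] := exists_expr_lt C r01 e0.
have : nbhs w (cylinder (mkseq w n) : set cantor_space).
  by apply: open_nbhs_nbhs; split; [exact: open_cylinder|exact: cylinder_mkseq].
apply: filterS => v /cylinder_mkseqP vw; apply: le_lt_trans ne.
by apply: h => i ni; rewrite vw.
Qed.

Lemma continuous_measurable_borel (R : realType) (f : cantor_space -> R) :
  continuous f -> measurable_fun setT (f : borelOmega -> R).
Proof.
move=> cf; apply: (measurability _ (measurable_realfun.RGenOInfty.measurableE R)).
move=> _ [_ [x ->] <-]; rewrite setTI; apply: sub_sigma_algebra.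
by move/continuousP : cf; apply; exact: interval_open.
Qed.

Section PosteriorLimit.
Variables (R : realType) (l th K : R).
Hypotheses (l1 : -1 < l < 1) (th1 : -1 < th < 1) (K0 : 0 < K).
Let post := posterior l th.
Let r := rate l th.
Hypothesis post_prefix : forall s t t',
  `|post (s ++ t) - post (s ++ t')| <= K * r ^+ size s.

Definition posterior_lim (w : cantor_space) : R :=
  inf [set x | exists n, x = post (mkseq w n) + K * r ^+ n].

Let r01 : 0 < r < 1. Proof. exact: rate_lt1. Qed.

Let Kr_ge0 n : 0 <= K * r ^+ n.
Proof. by move: r01 => /andP[? ?]; rewrite mulr_ge0 ?exprn_ge0 ?ltW. Qed.

Lemma mkseq_add (w : cantor_space) n k :
  mkseq w (n + k) = mkseq w n ++ [seq w i | i <- iota n k].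
Proof. by rewrite /mkseq iotaD map_cat. Qed.

Lemma posterior_mkseq w n k :
  `|post (mkseq w (n + k)) - post (mkseq w n)| <= K * r ^+ n.
Proof.
rewrite mkseq_add -[X in _ - post X]cats0.
by have := post_prefix (mkseq w n) [seq w i | i <- iota n k] [::];
  rewrite size_mkseq.
Qed.

Lemma posterior_lim_dist w n :
  `|posterior_lim w - post (mkseq w n)| <= K * r ^+ n.
Proof.
set S := [set x | exists n, x = post (mkseq w n) + K * r ^+ n].
have lb m : lbound S (post (mkseq w m) - K * r ^+ m).
  move=> _ [j ->]; have [mj|/ltnW jm] := leqP m j.
    have := posterior_mkseq w m (j - m); rewrite subnKC// ler_norml => /andP[h _].
    by have := Kr_ge0 j; lra.
  have := posterior_mkseq w j (m - j); rewrite subnKC// ler_norml => /andP[_ h].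
  by have := Kr_ge0 m; lra.
rewrite ler_norml; apply/andP; split.
  rewrite lerBrDl; apply: lb_le_inf; last exact: lb.
  by exists (post (mkseq w 0) + K * r ^+ 0), 0%N.
rewrite lerBlDl; apply: ge_inf; last by exists n.
by exists (post (mkseq w 0) - K * r ^+ 0); exact: lb.
Qed.

Lemma posterior_lim_agree n w w' : (forall i, (i < n)%N -> w i = w' i) ->
  `|posterior_lim w - posterior_lim w'| <= 2 * K * r ^+ n.
Proof.
move=> /eq_mkseqP ww'; have := posterior_lim_dist w n.
rewrite ww' => h; have h' := posterior_lim_dist w' n.
rewrite -mulrA mulr_natl mulr2n.
rewrite -[X in `|X - _|](subrK (post (mkseq w' n))) -addrA (le_trans (ler_normD _ _))//.
by rewrite lerD// distrC.
Qed.

Lemma posterior_lim_le1 w : `|posterior_lim w| <= 1.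
Proof.
rewrite -subr_le0; apply: (le_expr_le0 (C := K) r01) => n.
have := posterior_lim_dist w n; have := posterior_lt1 l1 th1 (mkseq w n).
rewrite -/post -ltr_norml => h1 h2.
have := ler_normD (posterior_lim w - post (mkseq w n)) (post (mkseq w n)).
by rewrite subrK; lra.
Qed.

Definition cond_prob (a : bool) (w : cantor_space) : R :=
  (1 + (-1) ^+ a * th * (l * posterior_lim w)) / 2.

Lemma cond_prob_scale a x y :
  `|(1 + (-1) ^+ a * th * (l * x)) / 2 - (1 + (-1) ^+ a * th * (l * y)) / 2| <=
  `|x - y| / 2.
Proof.
have -> : (1 + (-1) ^+ a * th * (l * x)) / 2 - (1 + (-1) ^+ a * th * (l * y)) / 2 =
   (-1) ^+ a * ((th * l) * (x - y)) / 2 by field.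
rewrite normrM normrMsign [`|2^-1|]gtr0_norm// ler_wpM2r//.
rewrite normrM ler_piMl// normrM mulr_ile1// ltW// ltr_norml//.
Qed.

Lemma cond_prob_agree a n w w' : (forall i, (i < n)%N -> w i = w' i) ->
  `|cond_prob a w - cond_prob a w'| <= K * r ^+ n.
Proof.
move=> /posterior_lim_agree h; apply: (le_trans (cond_prob_scale _ _ _)).
by move: h; lra.
Qed.

Lemma cond_prob_dist a w n :
  `|cond_prob a w - (1 + (-1) ^+ a * th * (l * post (mkseq w n))) / 2| <= K * r ^+ n.
Proof.
apply: (le_trans (cond_prob_scale _ _ _)).
by have := posterior_lim_dist w n; have := Kr_ge0 n; lra.
Qed.

Lemma cond_prob_in01 a w : 0 < cond_prob a w < 1.
Proof.
have : `|(-1) ^+ a * th * (l * posterior_lim w)| < 1.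
  rewrite -mulrA normrMsign mulrA normrM.
  apply: (@le_lt_trans _ _ `|th * l|).
    by rewrite ler_piMr// posterior_lim_le1.
  by have := mul_lt1 th1 l1; rewrite -ltr_norml.
by rewrite /cond_prob ltr_norml => /andP[? ?]; apply/andP; split; lra.
Qed.

Lemma cond_prob_add w : cond_prob false w + cond_prob true w = 1.
Proof. by rewrite /cond_prob expr0 expr1; field. Qed.

Lemma continuous_cond_prob a : continuous (cond_prob a).
Proof. by apply: (continuous_cylinder r01) => n w w'; exact: cond_prob_agree. Qed.

Definition g_fun (w : cantor_space) : R := cond_prob (w 0%N) (left_shift w).

Lemma g_fun_agree n w w' : (forall i, (i < n)%N -> w i = w' i) ->
  `|g_fun w - g_fun w'| <= (1 + K / r) * r ^+ n.
Proof.
move: r01 => /andP[r0 r1].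
case: n => [_|n ww'].
  rewrite expr0 mulr1 (@le_trans _ _ 1)//; last first.
    by rewrite lerDl divr_ge0// ltW.
  have /andP[? ?] := cond_prob_in01 (w 0%N) (left_shift w).
  have /andP[? ?] := cond_prob_in01 (w' 0%N) (left_shift w').
  by rewrite /g_fun ler_norml; apply/andP; split; lra.
rewrite /g_fun (ww' 0%N)//.
apply: (@le_trans _ _ (K * r ^+ n)).
  by apply: cond_prob_agree => i ni; exact: ww'.
have -> : (1 + K / r) * r ^+ n.+1 = r ^+ n.+1 + K * r ^+ n.
  by rewrite exprS; field; rewrite gt_eqF.
by rewrite lerDr exprn_ge0// ltW.
Qed.

Lemma continuous_g_fun : continuous g_fun.
Proof. by apply: (continuous_cylinder r01) => n w w'; exact: g_fun_agree. Qed.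

Lemma g_fun_in01 w : 0 < g_fun w < 1.
Proof. exact: cond_prob_in01. Qed.

Lemma g_fun_sum w : \sum_(a : bool) g_fun (scons a (left_shift w)) = 1.
Proof. by rewrite big_bool/= addrC; exact: cond_prob_add. Qed.

End PosteriorLimit.

Lemma measurable_bool_cylinder (a : bool) :
  measurable ([set w | w 0%N = a] : set borelOmega).
Proof.
have -> : [set w | w 0%N = a] = cylinder [:: a].
  apply/seteqP; split => w /=; first by move=> wa; apply/cylinderP; case.
  by move=> /cylinderP/(_ 0%N isT).
exact: measurable_cylinder.
Qed.

Lemma measurable_shift_preimage (A : set borelOmega) : measurable A ->
  measurable (left_shift @^-1` A : set borelOmega).
Proof.
by move=> mA; rewrite -[X in measurable X]setTI; exact: measurable_left_shift.
Qed.

Lemma trivIset_preimage {aT rT I : Type} (D : set I) (f : aT -> rT)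
    (F : I -> set rT) :
  trivIset D F -> trivIset D (fun i => f @^-1` F i).
Proof.
by move=> tF i j Di Dj [w [wi wj]]; apply: tF => //; exists (f w).
Qed.

Lemma eq_on_cylinders (R : realType) (mu nu : set borelOmega -> \bar R) :
  (forall A, measurable A -> mu A \is a fin_num) ->
  (forall A, measurable A -> (mu A + mu (~` A) = mu setT)%E) ->
  (forall A, measurable A -> (nu A + nu (~` A) = nu setT)%E) ->
  (forall F : (set borelOmega)^nat, (forall n, measurable (F n)) -> trivIset setT F ->
    mu (\bigcup_n F n) = (\sum_(n <oo) mu (F n))%E) ->
  (forall F : (set borelOmega)^nat, (forall n, measurable (F n)) -> trivIset setT F ->
    nu (\bigcup_n F n) = (\sum_(n <oo) nu (F n))%E) ->
  mu set0 = nu set0 ->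
  (forall s, mu (cylinder s) = nu (cylinder s)) ->
  forall A, measurable A -> mu A = nu A.
Proof.
move=> fin muC nuC muU nuU mu0 mus A mA.
apply: (@dynkin_induction _ borelOmega cylinders (fun A => mu A = nu A)
  measurable_cylinders cylinders_setI) => //.
- by rewrite -cylinder0.
- by move=> _ [->|[s _ <-]].
- move=> S mS muS.
  have := muC _ mS; rewrite -cylinder0 mus cylinder0 -(nuC _ mS) muS.
  rewrite ![(nu S + _)%E]addeC => /(congr1 (fun x => x - nu S)%E).
  by rewrite !addeK// -muS; exact: fin.
- by move=> F mF tF FE; rewrite muU// nuU//; apply: eq_eseriesr => n _.
- by rewrite -measurable_cylinders.
Qed.

Section HiddenMarkovLaw.
Variables (R : realType) (p eps : R).
Hypotheses (p01 : 0 < p < 1) (eps01 : 0 < eps < 1).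
Variable Q : probability borelOmega R.
Hypothesis law : forall s, Q (cylinder s) = (cylinder_prob p eps s)%:E.

Let cprob := cylinder_prob p eps.

Lemma law_fully_supported : fully_supported Q.
Proof.
move=> U oU [w Uw].
have [|n nU] := @nbhs_cylinder w U; first by move: oU; rewrite openE => /(_ w Uw).
apply: (@lt_le_trans _ _ (Q (cylinder (mkseq w n)))).
  by rewrite law lte_fin cylinder_prob_gt0.
apply: le_measure => //; rewrite inE; first exact: measurable_cylinder.
exact: sub_sigma_algebra.
Qed.

Lemma law_shift_cylinder s : Q (left_shift @^-1` cylinder s) = (cprob s)%:E.
Proof.
rewrite shift_cylinder measureU; [|exact: measurable_cylinder..|].
  rewrite [X in (X + _)%E]law [X in (_ + X)%E]law -EFinD.
  by rewrite cylinder_prob_cons2.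
by rewrite !cylinder_cons; apply/seteqP; split => // w [[/= -> _]] [].
Qed.

Lemma law_translation_invariant : translation_invariant Q.
Proof.
have pm := measurable_shift_preimage.
apply: eq_on_cylinders.
- by move=> A mA; apply: fin_num_measure; exact: pm.
- move=> A mA; rewrite preimage_setC -measureU//; try exact: pm.
  + by rewrite setUv preimage_setT.
  + by apply: measurableC; exact: pm.
  + by rewrite setICr.
- by move=> A mA; rewrite -measureU ?setUv ?setICr//; exact: measurableC.
- move=> F mF tF; rewrite preimage_bigcup measure_bigcup.
  + by apply: eq_eseriesl => n; rewrite in_setT.
  + by move=> n _; exact: pm.
  + exact: trivIset_preimage.
- by move=> F mF tF; rewrite measure_bigcup//; apply: eq_eseriesl => n; rewrite in_setT.
- by rewrite preimage_set0.
- by move=> s; rewrite law_shift_cylinder law.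
Qed.

Lemma cylinder_prob_rcons2 s : cprob (rcons s false) + cprob (rcons s true) = cprob s.
Proof.
apply: EFin_inj; rewrite EFinD /cprob -!law -measureU.
- by rewrite -cylinder_split.
- exact: measurable_cylinder.
- exact: measurable_cylinder.
- by apply/eqP; exact: cylinder_rcons_disj.
Qed.

Let l : R := 1 - 2 * p.
Let th : R := 1 - 2 * eps.
Let l1 : -1 < l < 1. Proof. exact: drift_lt1. Qed.
Let th1 : -1 < th < 1. Proof. exact: noise_lt1. Qed.
Variable K : R.
Hypothesis K0 : 0 < K.
Let r := rate l th.
Hypothesis post_prefix : forall s t t',
  `|posterior l th (s ++ t) - posterior l th (s ++ t')| <= K * r ^+ size s.
Let r01 : 0 < r < 1. Proof. exact: rate_lt1. Qed.

Let h a (w : borelOmega) : R := cond_prob l th K a (left_shift w).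

Lemma measurable_cond_prob a : measurable_fun setT (cond_prob l th K a : borelOmega -> R).
Proof.
by apply: continuous_measurable_borel; exact: (continuous_cond_prob l1 th1 K0 post_prefix).
Qed.

Let mh a : measurable_fun setT (h a).
Proof. exact: (measurableT_comp (measurable_cond_prob a) measurable_left_shift). Qed.

Let h01 a w : 0 < h a w < 1.
Proof. exact: (cond_prob_in01 l1 th1 K0 post_prefix). Qed.

Let ih a : Q.-integrable setT (EFin \o h a).
Proof.
apply: measurable_bounded_integrable => //.
  exact: le_lt_trans (probability_le1 Q measurableT) (ltry 1).
exists 1; split; first exact: num_real.
move=> x x1 w _; have /andP[w0 w1] := h01 a w.
by rewrite /= ger0_norm ?ltW// (lt_trans w1).
Qed.

Let ihD a D : measurable D -> Q.-integrable D (EFin \o h a).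
Proof. by move=> mD; apply: (integrableS _ mD _ (ih a)). Qed.

Let D s : set borelOmega := left_shift @^-1` cylinder s.
Let mD s : measurable (D s).
Proof. by apply: measurable_shift_preimage; exact: measurable_cylinder. Qed.

(* Cutting the cylinder [s] into cylinders of length [size s + k], on each of
   which [h] is constant up to [K * r ^+ (size s + k)]. *)
Lemma integral_cond_prob_approx a k s :
  ((cprob (a :: s) - K * r ^+ (size s + k) * cprob s)%:E <=
    \int[Q]_(w in D s) (h a w)%:E <=
   (cprob (a :: s) + K * r ^+ (size s + k) * cprob s)%:E)%E.
Proof.
elim: k s => [|k IH] s.
  pose c := cprob s; pose q := (1 + (-1) ^+ a * th * (l * posterior l th s)) / 2.
  rewrite addn0 -/c (_ : cprob (a :: s) = c * q)//.
  have hq w : D s w -> `|h a w - q| <= K * r ^+ size s.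
    move=> sw; have := cond_prob_dist l1 th1 K0 post_prefix a (left_shift w) (size s).
    by rewrite /h; move: sw; rewrite /D/=/cylinder/= => ->.
  have cstE (x : R) : (\int[Q]_(w in D s) x%:E = (x * c)%:E)%E.
    by rewrite integral_cst// EFinM; congr (_ * _)%E; exact: law_shift_cylinder.
  have icst (x : R) : Q.-integrable (D s) (fun=> x%:E).
    by apply: finite_measure_integrable_cst; exact: mD.
  rewrite (_ : c * q - _ = (q - K * r ^+ size s) * c); last by ring.
  rewrite (_ : c * q + _ = (q + K * r ^+ size s) * c); last by ring.
  rewrite -!cstE; apply/andP; split; apply: le_integral => //;
    try exact: ihD; move=> w; rewrite inE => /hq; rewrite lee_fin ler_norml => /andP[? ?]; lra.
have DE : D s = D (rcons s false) `|` D (rcons s true).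
  by rewrite /D -preimage_setU -cylinder_split.
rewrite DE integral_setU//; last 2 first.
- by rewrite -DE; apply/measurable_realfun.measurable_EFinP; exact: measurable_funTS.
- rewrite /D; apply/eqP; rewrite -preimage_setI; have /eqP -> := cylinder_rcons_disj s.
  by rewrite preimage_set0.
have := IH (rcons s false); have := IH (rcons s true).
rewrite !size_rcons !addSnnS => /andP[a1 a2] /andP[b1 b2].
have E1 := cylinder_prob_rcons2 s.
have := cylinder_prob_rcons2 (a :: s); rewrite !rcons_cons => E2.
apply/andP; split.
  apply: le_trans (leeD b1 a1); rewrite -EFinD lee_fin -E1 -E2.
  by rewrite le_eqVlt; apply/orP; left; apply/eqP; ring.
apply: (le_trans (leeD b2 a2)); rewrite -EFinD lee_fin -E1 -E2.
by rewrite le_eqVlt; apply/orP; left; apply/eqP; ring.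
Qed.

Lemma integral_cond_prob_cylinder a s :
  (\int[Q]_(w in D s) (h a w)%:E = (cprob (a :: s))%:E)%E.
Proof.
have fin : (\int[Q]_(w in D s) (h a w)%:E)%E \is a fin_num.
  by apply: integrable_fin_num => //; exact: ihD.
have B k := integral_cond_prob_approx a k s; move: B.
rewrite -(fineK fin); set x := fine _ => B; congr EFin.
have cs : 0 <= cprob s by rewrite ltW// cylinder_prob_gt0.
have bnd k : `|x - cprob (a :: s)| <= K * r ^+ size s * cprob s * r ^+ k.
  have := B k; rewrite !lee_fin exprD => /andP[B1 B2].
  rewrite ler_norml; apply/andP; split; lra.
by apply/eqP; rewrite -subr_eq0 -normr_le0; apply: (le_expr_le0 r01 bnd).
Qed.

Lemma law_cond_prob a :
  is_cond_prob Q future_algebra [set w : borelOmega | w 0%N = a] (h a).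
Proof.
split.
- move=> B mB; exists (cond_prob l th K a @^-1` B); last by rewrite setTI.
  by rewrite -[X in measurable X]setTI; exact: measurable_cond_prob.
- exact: ih.
move=> _ [A mA <-]; rewrite setTI; move: A mA.
have pm := measurable_shift_preimage.
have m0 := measurable_bool_cylinder a.
apply: eq_on_cylinders.
- move=> A mA; apply: integrable_fin_num; first exact: pm.
  by apply: ihD; exact: pm.
- move=> A mA; rewrite preimage_setC -integral_setU; first by rewrite setUv preimage_setT.
  + exact: pm.
  + by apply: measurableC; exact: pm.
  + by apply/measurable_realfun.measurable_EFinP; exact: measurable_funTS.
  + by apply/eqP; rewrite setICr.
- move=> A mA; rewrite preimage_setC -measureU.
  + by rewrite -setIUr setUv preimage_setT.
  + by apply: measurableI => //; exact: pm.
  + by apply: measurableI => //; apply: measurableC; exact: pm.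
  + by rewrite setIACA setICr setI0.
- move=> F mF tF; rewrite preimage_bigcup integral_bigcup//.
  + exact: trivIset_preimage.
  + by move=> n; exact: pm.
  + by apply: ihD; apply: bigcup_measurable => n _; exact: pm.
- move=> F mF tF; rewrite preimage_bigcup setI_bigcupr measure_bigcup.
  + by apply: eq_eseriesl => n; rewrite in_setT.
  + by move=> n _; apply: measurableI => //; exact: pm.
  + by apply: trivIset_setIl; exact: trivIset_preimage.
- by rewrite preimage_set0 integral_set0 setI0 measure0.
- move=> s; rewrite -cylinder_cons law; exact: integral_cond_prob_cylinder.
Qed.

Lemma law_g_measure : is_g_measure Q (g_fun l th K).
Proof.
split.
- exact: law_fully_supported.
- exact: law_translation_invariant.
- split; first exact: (continuous_g_fun l1 th1 K0 post_prefix).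
  exact: (g_fun_in01 l1 th1 K0 post_prefix).
- exact: g_fun_sum.
exists h; split; first exact: law_cond_prob.
by apply: aeW.
Qed.

End HiddenMarkovLaw.

Unset Implicit Arguments.

Theorem mainTheorem3 (R : realType) :
  exists rho_star : R -> R -> R,
    forall p eps : R, 0 < p < 1 -> 0 < eps < 1 ->
      (p != 2^-1 -> rho_star p eps < `|1 - 2 * p|) /\
      forall (d : measure_display) (T : measurableType d)
        (P : probability T R) (X Z : nat -> {RV P >-> bool})
        (Q : probability borelOmega R),
        stationary_symmetric_chain P p X ->
        iid_noise P eps Z ->
        independent_processes P X Z ->
        is_law P (fun n w => spin_mul (X n w) (Z n w)) Q ->
        exists g : cantor_space -> R,
          is_g_measure Q g /\
          exists C rho : R,
            [/\ 0 < C, 0 < rho < 1,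
                forall n : nat, (var_g g n <= (C * rho ^+ n)%:E)%E &
                rho <= rho_star p eps].
Proof.
exists (fun p eps => rate (1 - 2 * p) (1 - 2 * eps)) => p eps p01 eps01.
have l1 := drift_lt1 p01; have th1 := noise_lt1 eps01; split.
  by move=> p2; apply: rate_lt_norm => //; apply: contra p2 => /eqP ?; apply/eqP; lra.
move=> d T P X Z Q hX hZ hXZ hQ.
have [K K0 post_prefix] := posterior_prefix l1 th1.
have law := law_cylinder p01 eps01 hX hZ hXZ hQ.
have r01 := rate_lt1 l1 th1.
exists (g_fun (1 - 2 * p) (1 - 2 * eps) K); split; first exact: law_g_measure.
exists (1 + K / rate (1 - 2 * p) (1 - 2 * eps)), (rate (1 - 2 * p) (1 - 2 * eps)).
split=> //.
  by rewrite addr_gt0// divr_gt0//; case/andP: r01.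
move=> n; apply: ge_ereal_sup => _ [y [y' [yy' ->]]].
by rewrite lee_fin; exact: (g_fun_agree l1 th1 K0 post_prefix).
Qed.
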